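(* For a real number $\theta>1$ let $\Lambda_\theta=A\mathbb{Z}^2\subset\mathbb{R}^2$, where $A=\begin{pmatrix}\theta&-1\\1&\theta\end{pmatrix}$, and let $\hat{\hat\omega}(\Lambda_\theta)$ be its weak uniform Diophantine exponent (defined in the context). If $\theta\in\mathbb{Q}$, then $\hat{\hat\omega}(\Lambda_\theta)=\infty$. Moreover, $\{\hat{\hat\omega}(\Lambda_\theta)\,:\,\theta>1,\ \theta\notin\mathbb{Q}\}=[0,1/2]$.
   Context: For $\vec z=(z_1,\dots,z_d)\in\mathbb{R}^d$ put $|\vec z|=\max_i|z_i|$ and $\Pi(\vec z)=\prod_{i=1}^d|z_i|^{1/d}$. For a full-rank lattice $\Lambda\subset\mathbb{R}^d$, the weak uniform Diophantine exponent $\hat{\hat\omega}(\Lambda)$ is the supremum of all real $\gamma$ such that for every sufficiently large $t$ there exists a nonzero $\vec z\in\Lambda$ with $|\vec z|\le t$ and $\Pi(\vec z)\le t^{-\gamma}$. *)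

(* Defs.v *)
From HB Require Import structures.
From mathcomp Require Import all_boot all_order all_algebra.
From mathcomp Require Import all_classical all_reals all_analysis.
From mathcomp Require Import ring lra.

Set Implicit Arguments.
Unset Strict Implicit.
Unset Printing Implicit Defensive.

Import Order.TTheory GRing.Theory Num.Theory.
Import numFieldNormedType.Exports.

Local Open Scope classical_set_scope.
Local Open Scope ring_scope.

(* The lattice A Z^d; it has full rank exactly when A \in unitmx. *)
Definition lattice (R : realType) (d : nat) (A : 'M[R]_d) : set 'cV[R]_d :=
  [set A *m map_mx intr z | z in [set: 'cV[int]_d]].

(* Pi z = prod_i |z_i|^(1/d). For d > 0 it vanishes as soon as some z_i does,
   since 0 `^ x = 0 when x != 0. *)
Definition Pi (R : realType) (d : nat) (z : 'cV[R]_d) : R :=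
  \prod_(i < d) `|z i 0| `^ (d%:R^-1).

(* `|z| is the norm of the library on matrices, that is, the maximum of the
   absolute values of the entries (mx_normrE). *)
Definition weak_uniform_exponent (R : realType) (d : nat)
    (L : set 'cV[R]_d) : \bar R :=
  ereal_sup [set gamma%:E | gamma in [set gamma : R |
    \forall t \near +oo, exists z : 'cV[R]_d,
      [/\ L z, z != 0, `|z| <= t & Pi z <= t `^ (- gamma)]]].

Definition theta_mx (R : realType) (theta : R) : 'M[R]_2 :=
  \matrix_(i, j) nth 0 (nth [::] [:: [:: theta; -1]; [:: 1; theta]] i) j.

Definition theta_lattice (R : realType) (theta : R) : set 'cV[R]_2 :=
  lattice (theta_mx theta).

Lemma theta_mx_unit (R : realType) (theta : R) : theta_mx theta \in unitmx.
Proof.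
rewrite unitmxE unitfE (expand_det_row _ 0) !big_ord_recl big_ord0.
rewrite /cofactor !det_mx11 !mxE /= addr0 expr0 expr1.
by apply: lt0r_neq0; nra.
Qed.

(* Main.v *)
Require Import Defs.
From mathcomp Require Import all_boot all_order all_algebra.
From mathcomp Require Import all_classical all_reals all_analysis.
From mathcomp Require Import ring lra zify.

Import Order.TTheory GRing.Theory Num.Theory.
Import numFieldNormedType.Exports.

Local Open Scope classical_set_scope.
Local Open Scope ring_scope.

(* With L1 = theta x - y and L2 = x + theta y the lattice is
   {(L1, L2) | x, y integers}. It is invariant under the rotation by a right
   angle, so only points with |L1| <= |L2| matter, and for these |L2| >= 1.

   Upper bound 1/2: if gamma > 1/2 is admissible, take a primitive point v with
   |L1 L2|(v) = p, put t = p^(-1/(2 gamma)), and take a point v' admissible for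
   2 t. Then |L1 L2|(v') < p, so v' is not a multiple of v, and
   |det(v, v')| >= 1 gives 1 + theta^2 <= 3 t^(1 - 2 gamma), which fails for
   large t.

   Attaining x in [0, 1/2]: let p_n / q_n increase to theta, where
   q_{n+1} = a_n q_n - q_{n-1} and likewise for p_n, so that consecutive terms
   have determinant 1 and q_n theta - p_n is about 1 / q_{n+1}. Up to constants,
   the smallest products come from the points (q_n, p_n) and equal
   q_n / q_{n+1}. Choosing a_n so that q_{n+1} is about q_n^(1 / (1 - 2 x_n)),
   with x_n < 1/2 increasing to x, makes this q_{n+1}^(-2 x_n), and the exponent
   is x. *)
Section Exponent.
Context {R : realType}.
Implicit Types (theta gamma t : R) (x y : int).

(** * The two linear forms and the lattice in these coordinates *)

Definition form1 theta x y : R := theta * x%:~R - y%:~R.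
Definition form2 theta x y : R := x%:~R + theta * y%:~R.

(* By [approximableP], admissibility of [gamma] at [t], with the rotation by a
   right angle used to order the two coordinates. *)
Definition approximable theta gamma t := exists x y, [/\ (x, y) != (0, 0),
  `|form1 theta x y| <= `|form2 theta x y|, `|form2 theta x y| <= t &
  `|form1 theta x y| * `|form2 theta x y| <= t `^ (- (2 * gamma))].

Lemma ord2_cases (i : 'I_2) : i = 0 \/ i = 1.
Proof. by case: i => -[|[|//]] ?; [left|right]; apply: val_inj. Qed.

Lemma norm_cV2_le (z : 'cV[R]_2) t : 0 <= t ->
  (`|z| <= t) = (`|z 0 0| <= t) && (`|z 1 0| <= t).
Proof.
move=> t0; rewrite [`|z|]mx_normrE; apply/bigmax_leP/andP => [[_ H]|[z0 z1]].
  by split; [exact: (H (0, 0))|exact: (H (1, 0))].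
split=> // -[i j] _ /=; rewrite (ord1 j).
by case: (ord2_cases i) => ->.
Qed.

Lemma Pi_cV2 (z : 'cV[R]_2) : Pi z = (`|z 0 0| * `|z 1 0|) `^ 2^-1.
Proof.
rewrite /Pi !big_ord_recl big_ord0 mulr1 powRM//.
by congr (_ * `|z _ _| `^ _); apply: val_inj.
Qed.

(** Squaring removes the exponent 1/2 of [Pi]; this is where the factor 2 in [2 * gamma] comes
    from. *)
Lemma sqrt_le_powR (a t gamma : R) : 0 <= a -> 0 < t ->
  (a `^ 2^-1 <= t `^ (- gamma)) = (a <= t `^ (- (2 * gamma))).
Proof.
move=> a0 t0.
have -> : - (2 * gamma) = - gamma * 2 by ring.
rewrite powRrM -[2]/(2%:R) powR_mulrn ?powR_ge0// powR12_sqrt//.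
by rewrite -{2}(sqr_sqrtr a0) ler_sqr ?nnegrE ?sqrtr_ge0 ?powR_ge0.
Qed.

Lemma theta_latticeP theta (z : 'cV[R]_2) : theta_lattice theta z <->
  exists x y, z 0 0 = form1 theta x y /\ z 1 0 = form2 theta x y.
Proof.
have lift01 : lift ord0 ord0 = 1 :> 'I_2 by apply: val_inj.
have E (w : 'cV[int]_2) :
     (theta_mx theta *m map_mx intr w) 0 0 = form1 theta (w 0 0) (w 1 0)
  /\ (theta_mx theta *m map_mx intr w) 1 0 = form2 theta (w 0 0) (w 1 0).
  rewrite !mxE !big_ord_recl !big_ord0 lift01 !mxE /= /form1 /form2.
  by split; ring.
split=> [[w _ <-]|[x [y [z0 z1]]]]; first by exists (w 0 0), (w 1 0); exact: E.
exists (\col_i (if i == 0 then x else y)) => //.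
have [] := E (\col_i (if i == 0 then x else y)); rewrite mxE [_ 1 0]mxE /=.
move=> E0 E1; apply/matrixP => i j; rewrite (ord1 j).
by case: (ord2_cases i) => ->; [rewrite E0 z0|rewrite E1 z1].
Qed.

Lemma form1_rot theta x y : form1 theta (- y) x = - form2 theta x y.
Proof. by rewrite /form1 /form2 !raddfN /=; ring. Qed.

Lemma form2_rot theta x y : form2 theta (- y) x = form1 theta x y.
Proof. by rewrite /form1 /form2 !raddfN /=; ring. Qed.

Lemma forms_sqr theta x y : form1 theta x y ^+ 2 + form2 theta x y ^+ 2 =
  (1 + theta ^+ 2) * (x%:~R ^+ 2 + y%:~R ^+ 2).
Proof. by rewrite /form1 /form2; ring. Qed.

(** The matrix of the forms has determinant [1 + theta ^+ 2], and determinants multiply. *)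
Lemma forms_det theta x y x' y' :
  form1 theta x y * form2 theta x' y' - form1 theta x' y' * form2 theta x y =
  (1 + theta ^+ 2) * (x * y' - x' * y)%:~R.
Proof. by rewrite /form1 /form2 rmorphB !rmorphM /=; ring. Qed.

Lemma norm_intr_ge1 (m : int) : m != 0 -> 1 <= `|m%:~R : R|.
Proof. by move=> m0; rewrite -intr_norm -[1]/(1%:~R) ler_int; lia. Qed.

(** By [forms_sqr] the two squares sum to at least [1 + theta ^+ 2 >= 2], and the larger one carries
    at least half. *)
Lemma form2_ge1 theta x y : 1 < theta -> (x, y) != (0, 0) ->
  `|form1 theta x y| <= `|form2 theta x y| -> 1 <= `|form2 theta x y|.
Proof.
move=> th1 xy0 le12; have := forms_sqr theta x y.
have xy1 : 1 <= x%:~R ^+ 2 + y%:~R ^+ 2 :> R.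
  have [x0|x0] := eqVneq x 0.
    have /norm_intr_ge1 : y != 0 by apply: contraNneq xy0 => ->; rewrite x0.
    by rewrite -(real_normK (num_real y%:~R)); nra.
  by move/norm_intr_ge1: x0; rewrite -(real_normK (num_real x%:~R)); nra.
rewrite -(real_normK (num_real (form1 _ _ _))).
rewrite -(real_normK (num_real (form2 _ _ _))).
move: (normr_ge0 (form1 theta x y)) (normr_ge0 (form2 theta x y)) le12.
move: `|form1 _ _ _| `|form2 _ _ _| => a b a0 b0 ab E.
have a2b2 : a ^+ 2 <= b ^+ 2 by rewrite ler_sqr ?nnegrE.
rewrite leNgt; apply/negP => b1.
have : b ^+ 2 < 1 by nra.
have : 2 <= (1 + theta ^+ 2) * (x%:~R ^+ 2 + y%:~R ^+ 2) by nra.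
lra.
Qed.

Lemma approximableP theta gamma t : 1 < theta -> 0 < t ->
  (exists z : 'cV[R]_2, [/\ theta_lattice theta z, z != 0, `|z| <= t &
     Pi z <= t `^ (- gamma)]) <-> approximable theta gamma t.
Proof.
move=> th1 t0; split.
  move=> [z [/theta_latticeP[x [y [z0 z1]]] zN0]].
  rewrite norm_cV2_le ?(ltW t0)// Pi_cV2 sqrt_le_powR ?mulr_ge0// z0 z1.
  move=> /andP[le1 le2] lep.
  have xy0 : (x, y) != (0, 0).
    apply: contraNneq zN0 => -[x0 y0]; apply/eqP/matrixP => i j.
    rewrite (ord1 j) mxE; move: z0 z1.
    rewrite x0 y0 /form1 /form2 !mulr0 subr0 addr0 => z0 z1.
    by case: (ord2_cases i) => ->.
  have [le12|/ltW le21] := leP `|form1 theta x y| `|form2 theta x y|.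
    by exists x, y.
  exists (- y), x; rewrite form1_rot form2_rot normrN mulrC; split=> //.
  by apply: contraNneq xy0 => -[/eqP + ->]; rewrite oppr_eq0 => /eqP ->.
move=> [x [y [xy0 le12 le2 lep]]].
pose z : 'cV[R]_2 := \col_i (if i == 0 then form1 theta x y else form2 theta x y).
have z0 : z 0 0 = form1 theta x y by rewrite mxE.
have z1 : z 1 0 = form2 theta x y by rewrite mxE.
exists z; split.
- by apply/theta_latticeP; exists x, y.
- apply/eqP => /matrixP /(_ 1 0); rewrite z1 mxE => E.
  by have := form2_ge1 _ _ _ th1 xy0 le12; rewrite E normr0 ler10.
- by rewrite norm_cV2_le ?(ltW t0)// z0 z1 le2 (le_trans le12).
- by rewrite Pi_cV2 sqrt_le_powR ?mulr_ge0// z0 z1.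
Qed.

(** * Bounding the exponent through admissible [gamma]; rational [theta]; nonnegativity *)

Lemma exponentE theta : 1 < theta ->
  weak_uniform_exponent (theta_lattice theta) =
  ereal_sup [set gamma%:E | gamma in
    [set gamma : R | \forall t \near +oo, approximable theta gamma t]].
Proof.
move=> th1; rewrite /weak_uniform_exponent; congr (ereal_sup (image _ _)).
by apply/seteqP; split=> gamma /= H; near=> t;
  have t0 : 0 < t by []; apply/(approximableP _ _ _ th1 t0); near: t.
Unshelve. all: by end_near. Qed.

Lemma exponent_le theta (x : R) : 1 < theta ->
  (forall gamma, x < gamma ->
     ~ \forall t \near +oo, approximable theta gamma t) ->
  (weak_uniform_exponent (theta_lattice theta) <= x%:E)%E.
Proof.
move=> th1 H; rewrite exponentE//; apply: ge_ereal_sup => _ [gamma /= app <-].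
by rewrite lee_fin leNgt; apply/negP => /H.
Qed.

Lemma exponent_ge theta (x : R) : 1 < theta ->
  (forall gamma, gamma < x ->
     \forall t \near +oo, approximable theta gamma t) ->
  (x%:E <= weak_uniform_exponent (theta_lattice theta))%E.
Proof.
move=> th1 H; rewrite exponentE//; apply/lee_subgt0Pr => e e0.
apply: ereal_sup_ubound; exists (x - e) => //=; apply: H.
by rewrite ltrBlDr ltrDl.
Qed.

(** The lattice point given by the denominator and numerator of [theta] lies on a coordinate axis,
    so its product is 0 and it serves every [gamma]. *)
Lemma exponent_rational theta : 1 < theta -> rational theta ->
  weak_uniform_exponent (theta_lattice theta) = +oo%E.
Proof.
move=> th1 [r _ rE]; apply/eqP; rewrite -leye_eq leye_eq; apply/eqP.
apply/eq_infty => x; apply: exponent_ge => // gamma _.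
have E : form1 theta (denq r) (numq r) = 0.
  rewrite /form1 -rE /ratr divfK ?subrr//.
  by rewrite intr_eq0 denq_neq0.
near=> t; exists (denq r), (numq r); split.
- by apply: contraTneq (denq_neq0 r) => -[-> _]; rewrite eqxx.
- by rewrite E normr0.
- by near: t; apply: nbhs_pinfty_ge; rewrite num_real.
- by rewrite E normr0 mul0r powR_ge0.
Unshelve. all: by end_near. Qed.

Lemma near_powR_ge (K e : R) : 0 < e -> \forall t \near +oo, K <= t `^ e.
Proof.
move=> e0; near=> t.
have t1 : (`|K| + 1) `^ e^-1 <= t.
  by near: t; apply: nbhs_pinfty_ge; rewrite num_real.
apply: (@le_trans _ _ (`|K| + 1)); first by have := ler_norm K; lra.
have K0 : 0 <= `|K| + 1 by rewrite addr_ge0.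
rewrite -[leLHS](powRr1 K0) -(mulVf (lt0r_neq0 e0)) powRrM.
by apply: (ge0_ler_powR (ltW e0));
  rewrite ?nnegrE ?(le_trans (powR_ge0 _ _) t1) ?powR_ge0.
Unshelve. all: by end_near. Qed.

(** The fixed point (0, 1) has product [theta], while the bound on the product tends to infinity. *)
Lemma approximable_near_neg theta gamma : 1 < theta -> gamma < 0 ->
  \forall t \near +oo, approximable theta gamma t.
Proof.
move=> th1 g0; near=> t.
have th0 : 0 <= theta by lra.
exists 0, 1; rewrite /form1 /form2 mulr0 mulr1 sub0r add0r normrN normr1 mul1r.
rewrite ger0_norm//; split => //; first exact: ltW.
by near: t; apply: near_powR_ge; lra.
Unshelve. all: by end_near. Qed.

Lemma exponent_ge0 theta : 1 < theta ->
  (0 <= weak_uniform_exponent (theta_lattice theta))%E.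
Proof.
by move=> th1; apply: exponent_ge => // gamma; exact: approximable_near_neg.
Qed.

(** * The upper bound 1/2 for irrational [theta] *)

Lemma form1_neq0 theta x y : irrational theta -> (x, y) != (0, 0) ->
  form1 theta x y != 0.
Proof.
move=> irr; apply: contraNneq => E.
have [x0|x0] := eqVneq x 0.
  move: E; rewrite x0 /form1 mulr0 sub0r => /eqP.
  by rewrite oppr_eq0 intr_eq0 => /eqP ->.
case: irr; exists (y%:~R / x%:~R) => //=.
rewrite rmorphM /= fmorphV /= !ratr_int.
move/eqP: E; rewrite subr_eq0 => /eqP <-.
by rewrite mulfK// intr_eq0.
Qed.

Lemma ler_powR2r (a b e : R) : 0 < e -> 0 <= a -> 0 <= b ->
  (a `^ e <= b `^ e) = (a <= b).
Proof.
move=> e0 a0 b0; apply/idP/idP => [|ab].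
  have [//|ba] := leP a b; rewrite leNgt => /negP[].
  by apply: (gt0_ltr_powR e0); rewrite ?nnegrE.
exact: (ge0_ler_powR (ltW e0)).
Qed.

(** Dividing a point by its gcd shrinks both forms. Primitivity is recorded by Bezout coefficients,
    the form used in [product_parallel]. *)
Lemma approximable_primitive theta gamma t : 1 < theta ->
  approximable theta gamma t ->
  exists x y u v, [/\ u * x + v * y = 1,
    `|form1 theta x y| <= `|form2 theta x y|, `|form2 theta x y| <= t &
    `|form1 theta x y| * `|form2 theta x y| <= t `^ (- (2 * gamma))].
Proof.
move=> th1 [x [y [xy0 le12 le2 lep]]].
have [u [v uv]] := Bezoutz x y.
have g0 : gcdz x y != 0.
  by apply: contraNneq xy0 => /eqP; rewrite gcdz_eq0 => /andP[/eqP -> /eqP ->].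
have xE := divzK (dvdz_gcdl x y); have yE := divzK (dvdz_gcdr x y).
move: uv g0 xE yE le12 le2 lep.
move: (gcdz x y) (x %/ gcdz x y)%Z (y %/ gcdz x y)%Z => g x' y' uv g0 xE yE.
have /(norm_intr_ge1 _) g1 := g0.
have -> : form1 theta x y = form1 theta x' y' * g%:~R.
  by rewrite -xE -yE /form1 !rmorphM /=; ring.
have -> : form2 theta x y = form2 theta x' y' * g%:~R.
  by rewrite -xE -yE /form2 !rmorphM /=; ring.
rewrite !normrM ler_pM2r ?(lt_le_trans ltr01 g1)// => le12 le2 lep.
exists x', y', u, v; split => //.
- by apply: (mulIf g0); rewrite mul1r -[RHS]uv -xE -yE; ring.
- by apply: le_trans le2; rewrite ler_peMr.
- apply: le_trans lep; rewrite ler_pM//; by rewrite ler_peMr.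
Qed.

(** The second point is [m] times the first, with [m = u * x' + v * y'] a nonzero integer, so the
    product is scaled by the square of [m]. *)
Lemma product_parallel theta x y u v x' y' : u * x + v * y = 1 ->
  x * y' - x' * y = 0 -> (x', y') != (0, 0) ->
  `|form1 theta x y| * `|form2 theta x y| <=
  `|form1 theta x' y'| * `|form2 theta x' y'|.
Proof.
move=> uv /eqP; rewrite subr_eq0 => /eqP par N0.
set m := u * x' + v * y'.
have x'E : x' = m * x.
  have -> : m * x = u * x * x' + v * (x * y') by rewrite /m; ring.
  by rewrite par -[LHS]mulr1 -uv; ring.
have y'E : y' = m * y.
  have -> : m * y = u * (x' * y) + v * y * y' by rewrite /m; ring.
  by rewrite -par -[LHS]mulr1 -uv; ring.
have /norm_intr_ge1 m1 : m != 0.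
  by apply: contraNneq N0 => m0; rewrite x'E y'E m0 !mul0r.
have -> : form1 theta x' y' = m%:~R * form1 theta x y.
  by rewrite x'E y'E /form1 !rmorphM /=; ring.
have -> : form2 theta x' y' = m%:~R * form2 theta x y.
  by rewrite x'E y'E /form2 !rmorphM /=; ring.
by rewrite !normrM ler_pM// ler_peMl.
Qed.

Lemma forms_det_le theta x y x' y' : 1 < theta -> x * y' - x' * y != 0 ->
  1 + theta ^+ 2 <= `|form1 theta x y| * `|form2 theta x' y'| +
    `|form1 theta x' y'| * `|form2 theta x y|.
Proof.
move=> th1 /norm_intr_ge1 d1; rewrite -!normrM.
apply: le_trans (ler_normB _ _); rewrite forms_det normrM ger0_norm; nra.
Qed.

(** Since [b] and [b'] are at least 1, both [a] and [a'] are at most [a * b]; the sum is then at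
    most [3 * t * (a * b)], hence at most 3/4. *)
Lemma cross_terms_le1 (a b a' b' t : R) : 0 <= a -> 1 <= b -> b <= t ->
  0 <= a' -> 1 <= b' -> b' <= 2 * t -> a' * b' <= a * b ->
  t * (a * b) <= 4^-1 ->
  a * b' + a' * b <= 1.
Proof.
move=> a0 b1 bt a'0 b'1 b't le tab.
have a_le : a <= a * b by nra.
have a'_le : a' <= a * b by nra.
have : a * b' <= (a * b) * (2 * t) by apply: ler_pM => //; lra.
have : a' * b <= (a * b) * t by apply: ler_pM => //; lra.
lra.
Qed.

Lemma exponent_le_half theta : 1 < theta -> irrational theta ->
  (weak_uniform_exponent (theta_lattice theta) <= (1 / 2)%:E)%E.
Proof.
move=> th1 irr; apply: exponent_le => // gamma gamma_gt [M [_ appM]].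
have g0 : 0 < 2 * gamma by lra.
have [|N [_ bigN]] := near_powR_ge 4 (2 * gamma - 1); first lra.
pose t0 := Num.max 1 (Num.max (M + 1) (N + 1)).
have [t0_ge1 Mt0 Nt0] : [/\ 1 <= t0, M < t0 & N < t0].
  by rewrite /t0 !le_max lexx !lt_max !ltrDl !ltr01 !orbT.
have [x [y [u [v [uv le12 le2 lep]]]]] :=
  approximable_primitive _ _ _ th1 (appM _ Mt0).
have xy0 : (x, y) != (0, 0).
  by apply/eqP => -[x0 y0]; move: uv; rewrite x0 y0 !mulr0.
have b1 := form2_ge1 _ _ _ th1 xy0 le12.
have a0 : 0 < `|form1 theta x y| by rewrite normr_gt0 form1_neq0.
set a := `|form1 theta x y| in le12 lep a0 *.
set b := `|form2 theta x y| in le12 le2 lep b1 *.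
pose p := a * b.
have p0 : 0 < p by rewrite /p; nra.
pose t := p^-1 `^ (2 * gamma)^-1.
have tE : t `^ (2 * gamma) = p^-1.
  by rewrite /t -powRrM mulVf ?lt0r_neq0// powRr1// invr_ge0 ltW.
have t0_le : t0 <= t.
  rewrite -(ler_powR2r _ _ _ g0) ?powR_ge0//; last lra.
  rewrite tE -[leLHS]invrK lef_pV2 ?posrE ?invr_gt0 ?powR_gt0//; last lra.
  by rewrite -powRN.
have t_gt0 : 0 < t by lra.
(* The factor 2 makes the product of the new point strictly less than [p], which rules out a
   multiple of the first point. *)
have [|x' [y' [xy'0 le12' le2' lep']]] := appM (2 * t); first lra.
have b1' := form2_ge1 _ _ _ th1 xy'0 le12'.
have lt_p : (2 * t) `^ (- (2 * gamma)) < p.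
  rewrite powRN -[ltRHS]invrK ltf_pV2 ?posrE ?invr_gt0 ?powR_gt0//; last lra.
  by rewrite -tE; apply: (gt0_ltr_powR g0); rewrite ?nnegrE; lra.
have d0 : x * y' - x' * y != 0.
  apply: contraTneq lt_p => d0; rewrite -leNgt; apply: le_trans lep'.
  exact: product_parallel uv d0 xy'0.
have := forms_det_le _ _ _ _ _ th1 d0; rewrite -/a -/b.
have tp : t * p <= 4^-1.
  have -> : t * p = (t `^ (2 * gamma - 1))^-1.
    rewrite powRB; last by rewrite (lt0r_neq0 t_gt0) implybT.
    by rewrite tE powRr1 ?invfM ?invrK 1?mulrC// ltW.
  have bigt : 4 <= t `^ (2 * gamma - 1) by apply: bigN; lra.
  by rewrite lef_pV2 ?posrE ?(powR_gt0 _ t_gt0).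
have : 1 <= theta ^+ 2 by nra.
have : a * `|form2 theta x' y'| + `|form1 theta x' y'| * b <= 1.
  apply: (@cross_terms_le1 _ _ _ _ t); rewrite ?(ltW a0)//.
    exact: le_trans t0_le.
  exact/ltW/(le_lt_trans lep').
lra.
Qed.

(** * Approximation of [theta] from below by a sequence of fractions *)

(** Modelled on continued fractions with minus signs: the fractions increase to [theta], so [form1]
    stays positive and the determinant is 1 at every step, without alternating signs. *)
Definition convergents theta (p q : nat -> int) := [/\ q 0%N = 1,
  forall n, 2 * q n <= q n.+1,
  forall n, p n.+1 * q n - p n * q n.+1 = 1 &
  forall n, (q n.+1)%:~R^-1 <= form1 theta (q n) (p n) <= 2 / (q n.+1)%:~R].

Section Convergents.
Context (theta : R) (p q : nat -> int).
Hypothesis pq : convergents theta p q.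

Lemma convergents_q_gt n : n%:Z < q n.
Proof.
case: pq => q0 q2 _ _.
by elim: n => [|n IH]; [rewrite q0|have := q2 n; lia].
Qed.

Lemma convergents_q_ge1 n : 1 <= (q n)%:~R :> R.
Proof. by rewrite -[1]/(1%:~R) ler_int; have := convergents_q_gt n; lia. Qed.

Lemma convergents_q_mono m n : (m <= n)%N -> (q m)%:~R <= (q n)%:~R :> R.
Proof.
move=> mn; rewrite ler_int; elim: n mn => [|n IH]; first by case: m.
rewrite leq_eqVlt => /orP[/eqP -> //|/IH mn].
by case: pq => _ /(_ n) q2 _ _; have := convergents_q_gt n; lia.
Qed.

(** If [theta] had denominator [d], then [d * form1 theta (q n) (p n)] would be a positive integer,
    yet it is at most [2 * d / q n.+1], which is below 1 for large [n]. *)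
Lemma convergents_irrational : irrational theta.
Proof.
move=> [r _ rE]; have d0 := denq_gt0 r.
have dE : theta * (denq r)%:~R = (numq r)%:~R.
  by rewrite -rE /ratr divfK// intr_eq0 denq_neq0.
pose n := (2 * `|denq r|)%N; case: pq => _ _ _ /(_ n) /andP[l1 l2].
have q'1 := convergents_q_ge1 n.+1.
have mE : (denq r)%:~R * form1 theta (q n) (p n) =
    (numq r * q n - denq r * p n)%:~R.
  by rewrite rmorphB !rmorphM /= -dE /form1; ring.
have f0 : 0 < form1 theta (q n) (p n).
  by apply: lt_le_trans l1; rewrite invr_gt0; lra.
have d0' : 0 < (denq r)%:~R :> R by rewrite ltr0z.
have m1 : 1 <= (denq r)%:~R * form1 theta (q n) (p n).
  have : 0 < (denq r)%:~R * form1 theta (q n) (p n) by nra.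
  by rewrite mE ltr0z -[1]/(1%:~R) ler_int; lia.
have : (denq r)%:~R * (2 / (q n.+1)%:~R) < 1 :> R.
  rewrite mulrA ltr_pdivrMr ?mul1r; last lra.
  rewrite -[2]/(2%:~R) -intrM ltr_int.
  by have := convergents_q_gt n.+1; rewrite /n; lia.
by nra.
Qed.

Hypothesis theta_gt1 : 1 < theta.

Lemma convergents_form2 n :
  (q n)%:~R <= form2 theta (q n) (p n) <= (1 + theta ^+ 2) * (q n)%:~R.
Proof.
case: (pq) => _ /(_ n) q2 _ /(_ n) /andP[l1 l2].
rewrite /form1 /form2 in l1 l2 *.
have q1 := convergents_q_ge1 n; have q'1 := convergents_q_ge1 n.+1.
have : (2 * q n)%:~R <= (q n.+1)%:~R :> R by rewrite ler_int.
rewrite rmorphM /= => q2'.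
have : 2 / (q n.+1)%:~R <= 1 :> R by rewrite ler_pdivrMr; lra.
have : 0 < (q n.+1)%:~R^-1 :> R by rewrite invr_gt0; lra.
move=> i0 i1; have th1 : 1 < theta := theta_gt1.
have : (q n)%:~R <= theta * (q n)%:~R by rewrite ler_peMl//; lra.
(* Here [form1] is at most 1, so [p n] is at least [theta * q n - 1], hence nonnegative. *)
move=> qtheta; have p0 : 0 <= theta * (p n)%:~R by rewrite mulr_ge0//; lra.
have : theta * (p n)%:~R <= theta * (theta * (q n)%:~R).
  by rewrite ler_wpM2l//; lra.
by move=> ?; apply/andP; split; lra.
Qed.

(* Take [q k <= 2 |L2| < q k.+1]. A point parallel to [(q k, p k)] is a multiple
   of it; for any other point the determinant inequality gives [1 / 4]. *)
Lemma convergents_product_ge x y n : (x, y) != (0, 0) ->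
  `|form1 theta x y| <= `|form2 theta x y| ->
  2 * `|form2 theta x y| < (q n.+1)%:~R ->
  exists2 k, (k <= n)%N &
    Num.min 4^-1 ((q k)%:~R / (q k.+1)%:~R) <=
    `|form1 theta x y| * `|form2 theta x y|.
Proof.
move=> xy0 le12 lt2; have b1 := form2_ge1 _ _ _ theta_gt1 xy0 le12.
have ex : exists m, 2 * `|form2 theta x y| < (q m)%:~R by exists n.+1.
(* The least index is not 0, because [q 0 = 1] while [2 * |L2|] is at least 2. *)
case: (ex_minnP ex) => -[|k] ltk mink.
  by case: pq ltk => -> *; exfalso; lra.
exists k; first exact: (mink n.+1 lt2).
have qk : (q k)%:~R <= 2 * `|form2 theta x y|.
  by rewrite leNgt; apply/negP => /mink; rewrite ltnn.
have q1 := convergents_q_ge1 k; have q'1 := convergents_q_ge1 k.+1.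
have /andP[l2 u2] := convergents_form2 k.
have [_ _ /(_ k) det /(_ k) /andP[l1 u1]] := pq.
have i0 : 0 < (q k.+1)%:~R^-1 :> R by rewrite invr_gt0; lra.
have n1 : `|form1 theta (q k) (p k)| = form1 theta (q k) (p k).
  by rewrite ger0_norm//; lra.
have n2 : `|form2 theta (q k) (p k)| = form2 theta (q k) (p k).
  by rewrite ger0_norm//; lra.
rewrite ge_min; apply/orP.
have [d0|d0] := eqVneq (q k * y - x * p k) 0; [right|left].
  have uv : p k.+1 * q k + - q k.+1 * p k = 1 by rewrite -[RHS]det; ring.
  apply: le_trans (product_parallel _ _ _ _ _ _ _ uv d0 xy0).
  by rewrite n1 n2 mulrC ler_pM//; lra.
have := forms_det_le _ _ _ _ _ theta_gt1 d0; rewrite n1 n2.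
clear mink lt2 le12; move: (normr_ge0 (form1 theta x y)) b1 ltk qk.
move: (`|form1 _ _ _|) (`|form2 _ _ _|) => a b a0 b1 ltk qk.
have : form1 theta (q k) (p k) * b <= 1.
  apply: (@le_trans _ _ (2 / (q k.+1)%:~R * b)).
    by rewrite ler_wpM2r//; lra.
  by rewrite mulrAC ler_pdivrMr; lra.
move=> h1 h2.
have th1 : 1 < theta := theta_gt1.
have C2 : 2 <= 1 + theta ^+ 2 by nra.
have h3 : a * form2 theta (q k) (p k) <= a * ((1 + theta ^+ 2) * (q k)%:~R).
  by rewrite ler_wpM2l.
(* With [C = 1 + theta ^+ 2], the previous bounds give [C <= 1 + a * C * q k], and [C - 1 >= C / 2].
   Combined with [q k <= 2 * b] this yields [a * b >= 1/4]. *)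
have h4 : 2^-1 <= a * (q k)%:~R.
  have C0 : 0 < 1 + theta ^+ 2 by lra.
  by rewrite -(ler_pM2l C0) mulrCA; lra.
nra.
Qed.

End Convergents.

(** * Construction of [theta] from prescribed coefficients *)

(** Keeps two consecutive (numerator, denominator) pairs, starting from the formal fraction -1/0 and
    from 1/1. The coefficient may depend on the current denominator, so that growth can be
    prescribed. *)
Fixpoint recurrence (a : nat -> int -> int) (n : nat) :
    (int * int) * (int * int) :=
  if n is n'.+1 then
    let: (prev, cur) := recurrence a n' in
    let c := a n' cur.2 in (cur, (c * cur.1 - prev.1, c * cur.2 - prev.2))
  else ((-1, 0), (1, 1)).

Lemma exists_recurrence (a : nat -> int -> int) : (forall n z, 3 <= a n z) ->
  exists p q : nat -> int, [/\ p 0%N = 1, q 0%N = 1,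
    forall n, p n.+1 * q n - p n * q n.+1 = 1 &
    forall n, 2 * q n <= q n.+1 /\
      (a n (q n) - 1) * q n <= q n.+1 <= a n (q n) * q n].
Proof.
move=> a3; pose s := recurrence a.
(* Ordered denominators place [c * q - q'] between [(c - 1) * q] and [c * q]; with [c >= 3] it is at
   least [2 * q]. *)
have s_inv n : [/\ (s n).2.1 * (s n).1.2 - (s n).1.1 * (s n).2.2 = 1,
    0 <= (s n).1.2 <= (s n).2.2 & 1 <= (s n).2.2].
  elim: n => [//|n]; rewrite /s /=; case: (recurrence a n) => [[p' q'] [p q]] /=.
  move=> [det /andP[q'0 q'q] q1]; have := a3 n q; move: (a n q) => c c3.
  split; [rewrite -[RHS]det; ring|apply/andP; split|]; nia.
exists (fun n => (s n).2.1), (fun n => (s n).2.2); split=> // n.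
  have := s_inv n; rewrite /s /=; case: (recurrence a n) => [[p' q'] [p q]] /=.
  by move=> [det _ _]; rewrite -[RHS]det; ring.
have := s_inv n; rewrite /s /=; case: (recurrence a n) => [[p' q'] [p q]] /=.
move=> [_ /andP[q'0 q'q] q1]; have := a3 n q; move: (a n q) => c c3.
by split; [|apply/andP; split]; nia.
Qed.

(** The fractions [s n] grow by [d n = 1 / (q n * q n.+1)], and [d] at least halves at each step, so
    their supremum [theta] satisfies [d n <= theta - s n <= 2 * d n]. Multiplying by [q n] gives the
    bounds on [form1]. *)
Lemma exists_convergents (a : nat -> int -> int) : (forall n z, 3 <= a n z) ->
  exists theta (p q : nat -> int), [/\ 1 < theta, convergents theta p q &
    forall n, (a n (q n) - 1) * q n <= q n.+1 <= a n (q n) * q n].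
Proof.
move=> a3; have [p [q [p0 q0 det q_rec]]] := exists_recurrence _ a3.
have qS n : 2 * q n <= q n.+1 by case: (q_rec n).
have q_ge1 n : 1 <= q n.
  by elim: n => [|n IH]; [rewrite q0|have := qS n; lia].
have qr n : 0 < (q n)%:~R :> R by rewrite ltr0z; have := q_ge1 n; lia.
pose s n : R := (p n)%:~R / (q n)%:~R.
pose d n : R := ((q n)%:~R * (q n.+1)%:~R)^-1.
have sS n : s n.+1 = s n + d n.
  have : (p n.+1 * q n - p n * q n.+1)%:~R = 1 :> R by rewrite det.
  rewrite rmorphB !rmorphM /= /s /d => detR.
  by rewrite -[X in _ + X]mul1r -[X in _ + X * _]detR; field; rewrite !lt0r_neq0.
have d0 n : 0 < d n by rewrite invr_gt0 mulr_gt0.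
have dS n : 2 * d n.+1 <= d n.
  rewrite /d ler_pdivrMr ?mulr_gt0//.
  have -> : ((q n)%:~R * (q n.+1)%:~R)^-1 * ((q n.+1)%:~R * (q n.+2)%:~R) =
      (q n.+2)%:~R / (q n)%:~R :> R.
    by field; rewrite !lt0r_neq0.
  rewrite ler_pdivlMr//.
  have : (4 * q n)%:~R <= (q n.+2)%:~R :> R.
    by rewrite ler_int; have := qS n; have := qS n.+1; lia.
  by rewrite rmorphM /=; have := qr n; lra.
have s_le n m : s m <= s n + 2 * d n.
  have [mn|/ltnW nm] := leqP m n.
    apply: (@le_trans _ _ (s n)); last by have := d0 n; lra.
    elim: n mn => [|n IH]; first by case: m.
    rewrite leq_eqVlt => /orP[/eqP -> //|/IH]; rewrite sS; have := d0 n; lra.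
  (* Strengthened for the induction: the term [- 2 * d m] absorbs the next increment. *)
  suff : s m <= s n + 2 * d n - 2 * d m by have := d0 m; lra.
  elim: m nm => [|m IH]; first by case: n => //; lra.
  rewrite leq_eqVlt => /orP[/eqP -> |/IH]; first lra.
  by rewrite sS; have := dS m; lra.
pose theta := sup (range s).
have s_ub n : s n <= theta.
  apply: ub_le_sup; last by exists n.
  by exists (s 0%N + 2 * d 0%N) => _ [m _ <-].
have theta_le n : theta <= s n + 2 * d n.
  by apply: ge_sup => [|_ [m _ <-] //]; exists (s 0%N); exists 0%N.
exists theta, p, q; split.
- apply: lt_le_trans (s_ub 1%N); rewrite sS /s p0 q0 divff ?oner_eq0//.
  by rewrite ltrDl.
- split=> // n; have q0' := lt0r_neq0 (qr n).
  have E e : form1 e (q n) (p n) = (q n)%:~R * (e - s n).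
    by rewrite /form1 /s mulrBr mulrCA divff// mulr1 mulrC.
  have D : (q n.+1)%:~R^-1 = (q n)%:~R * d n by rewrite /d invfM mulrA divff// mul1r.
  have qn := qr n; rewrite E D; apply/andP; split.
    by rewrite ler_pM2l// lerBrDl -sS.
  by rewrite mulrCA ler_pM2l// lerBlDl.
- by move=> n; case: (q_rec n).
Qed.

(** * From the growth of denominators to the exponent *)

(* [Q n / Q n.+1] is comparable to [Q n.+1 `^ (- (2 * xi n))]. *)
Section Rate.
Context (theta x : R) (xi : nat -> R) (p q : nat -> int).
Hypotheses (theta_gt1 : 1 < theta) (pq : convergents theta p q).

Local Notation Q n := ((q n)%:~R : R).

(** Test [t = T / 4] with [T = Q n.+1] large: every eligible point has product at least [T]^ (- (2 *
    x)) / 4[, which exceeds]t [^ (- (2 * gamma))] because [x < gamma]. *)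
Lemma not_approximable gamma : 0 <= x < gamma -> (forall n, xi n <= x) ->
  (forall n, 4^-1 * Q n.+1 `^ (- (2 * xi n)) <= Q n / Q n.+1) ->
  ~ \forall t \near +oo, approximable theta gamma t.
Proof.
move=> /andP[x0 xg] xi_le rate [M [_ appM]].
have [|N [_ bigN]] :=
  near_powR_ge (4 * 4 `^ (2 * gamma) + 1 : R) (2 * gamma - 2 * x); first lra.
(* Since [Q n.+1 > n.+1], this index makes [T] exceed both [4 * M] and [N]. *)
pose n := (Num.truncn (`|4 * M|)%R + Num.truncn (`|N|)%R).+1.
pose T := Q n.+1.
have T_gt : n.+1%:R < T.
  rewrite -[n.+1%:R]/((n.+1)%:Z%:~R) ltr_int; exact: convergents_q_gt pq _.
have MT : 4 * M < T.
  apply: le_lt_trans (ler_norm _) _; apply: lt_trans T_gt.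
  by apply: lt_le_trans (truncnS_gt _) _; rewrite ler_nat /n ltnS leqW ?leq_addr.
have NT : N < T.
  apply: le_lt_trans (ler_norm _) _; apply: lt_trans T_gt.
  by apply: lt_le_trans (truncnS_gt _) _; rewrite ler_nat /n ltnS leqW ?leq_addl.
have T1 : 1 <= T by exact: convergents_q_ge1 pq _.
have Tpos : 0 < T by lra.
have T0 : T != 0 by exact: lt0r_neq0.
have [|u [v [uv0 le12 le2 lep]]] := appM (T / 4); first lra.
have lt2 : 2 * `|form2 theta u v| < T by lra.
have [k kn] := convergents_product_ge _ _ _ pq theta_gt1 _ _ _ uv0 le12 lt2.
apply/negP; rewrite -ltNge; apply: le_lt_trans lep _.
have Tx0 : 0 < T `^ (2 * x) by apply: powR_gt0; lra.
apply: (@lt_le_trans _ _ (4^-1 * T `^ (- (2 * x)))).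
  rewrite !powRN -invfM ltf_pV2 ?posrE ?mulr_gt0 ?powR_gt0 ?divr_gt0//; [|lra..].
  rewrite powRM ?invr_ge0//; last lra.
  have : 4 * 4 `^ (2 * gamma) < T `^ (2 * gamma - 2 * x).
    by have := bigN _ NT; lra.
  rewrite powRB ?T0 ?implybT// ltr_pdivlMr//.
  rewrite -powR_inv1// -powRrM mulN1r powRN ltr_pdivlMr ?powR_gt0//.
  by congr (_ < _); ring.
rewrite le_min; apply/andP; split.
  rewrite ger_pMr// powRN invf_le1//.
  by rewrite -[leLHS](powRr0 T); apply: ler_powR => //; lra.
apply: le_trans (rate k); rewrite ler_pM2l// !powRN.
have Qk1 : 1 <= Q k.+1 by exact: convergents_q_ge1 pq _.
have QT : Q k.+1 <= T by exact: convergents_q_mono pq _ _ _.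
have Qk0 : 0 < Q k.+1 by lra.
rewrite lef_pV2 ?posrE ?powR_gt0//.
apply: (@le_trans _ _ (Q k.+1 `^ (2 * x))).
  by apply: ler_powR => //; have := xi_le k; lra.
have x2 : 0 <= 2 * x by lra.
by apply: (ge0_ler_powR x2); rewrite ?nnegrE; lra.
Qed.

(** For [C * Q n <= t < C * Q n.+1] the point [(q n, p n)] works: its product is at most
    [2 * C * Q n / Q n.+1], and the gap between [gamma] and [gamma'] absorbs the constants. *)
Lemma near_approximable gamma gamma' N : 0 <= gamma < gamma' ->
  (forall n, (N <= n)%N -> gamma' <= xi n) ->
  (forall n, Q n / Q n.+1 <= Q n.+1 `^ (- (2 * xi n))) ->
  \forall t \near +oo, approximable theta gamma t.
Proof.
move=> /andP[g0 gg'] xi_ge rate.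
pose C := 1 + theta ^+ 2; have C1 : 1 <= C by rewrite /C; nra.
have [|M [_ bigM]] :=
  near_powR_ge (2 * C * C `^ (2 * gamma)) (2 * gamma' - 2 * gamma); first lra.
near=> t.
have tN : C * Q N <= t by near: t; apply: nbhs_pinfty_ge; rewrite num_real.
have tM : C * M <= t by near: t; apply: nbhs_pinfty_ge; rewrite num_real.
have t1 : 1 <= t by near: t; apply: nbhs_pinfty_ge; rewrite num_real.
have ex : exists m, t < C * Q m.
  exists (Num.truncn t).+1; apply: (lt_trans (truncnS_gt t)).
  apply: (@lt_le_trans _ _ (Q (Num.truncn t).+1)).
    rewrite -[_.+1%:R]/((_.+1)%:Z%:~R) ltr_int; exact: convergents_q_gt pq _.
  by rewrite ler_peMl// (le_trans ler01)// (convergents_q_ge1 _ _ _ pq).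
case: (ex_minnP ex) => m ltm minm.
(* As [t >= C * Q N], the least [m] is a successor [n.+1] with [n >= N], where the lower bound on
   [xi] holds. *)
have Nm : (N < m)%N.
  rewrite ltnNge; apply/negP => mN; move: ltm; rewrite ltNge => /negP; apply.
  apply: le_trans tN; rewrite ler_pM2l ?(lt_le_trans ltr01 C1)//.
  exact: convergents_q_mono pq _ _ _.
case: m Nm ltm minm => [//|n] Nn ltn minn.
have Cqt : C * Q n <= t by rewrite leNgt; apply/negP => /minn; rewrite ltnn.
have q1 : 1 <= Q n by exact: convergents_q_ge1 pq _.
have q'1 : 1 <= Q n.+1 by exact: convergents_q_ge1 pq _.
have /andP[l2 u2] := convergents_form2 _ _ _ pq theta_gt1 n.
have [_ _ _ /(_ n) /andP[l1 u1]] := pq.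
have i0 : 0 < (Q n.+1)^-1 by rewrite invr_gt0; lra.
have q2 : 2 <= Q n.+1.
  have : (2 * q n)%:~R <= Q n.+1 by case: pq => _ /(_ n) q2 _ _; rewrite ler_int.
  by rewrite rmorphM /=; lra.
have i2 : 2 / Q n.+1 <= 1 by rewrite ler_pdivrMr; lra.
exists (q n), (p n).
rewrite (ger0_norm (_ : 0 <= form1 _ _ _)); last lra.
rewrite (ger0_norm (_ : 0 <= form2 _ _ _)); last lra.
split.
- by apply/eqP => -[qn0 _]; move: q1; rewrite qn0 ler10.
- lra.
- by rewrite (le_trans u2).
apply: (@le_trans _ _ (2 * C * Q n.+1 `^ (- (2 * gamma')))).
  apply: (@le_trans _ _ ((2 / Q n.+1) * (C * Q n))).
    by rewrite ler_pM//; lra.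
  have -> : 2 / Q n.+1 * (C * Q n) = 2 * C * (Q n / Q n.+1) by ring.
  rewrite ler_pM2l; last lra.
  apply: le_trans (rate n) _; apply: ler_powR => //.
  by have := xi_ge n Nn; lra.
have T0 : Q n.+1 != 0 by apply: lt0r_neq0; lra.
have /bigM : M < Q n.+1.
  by rewrite -(ltr_pM2l (lt_le_trans ltr01 C1)) (le_lt_trans tM).
rewrite powRB ?T0 ?implybT// ler_pdivlMr ?powR_gt0; last lra.
move=> lb; rewrite !powRN ler_pdivrMr ?powR_gt0; last lra.
rewrite [leRHS]mulrC ler_pdivlMr ?powR_gt0; last lra.
apply: le_trans lb; rewrite -[leRHS]mulrA ler_pM2l; last lra.
have g2 : 0 <= 2 * gamma by lra.
rewrite -powRM; [|lra..].
by apply: (ge0_ler_powR g2); rewrite ?nnegrE; lra.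
Unshelve. all: by end_near. Qed.

End Rate.

(** * Attaining every value in [0, 1/2] *)

Lemma powR_quotient_bounds (q T e : R) : 1 <= q -> 0 < e <= 1 ->
  q `^ e^-1 <= T <= 4 * q `^ e^-1 ->
  4^-1 * T `^ (e - 1) <= q / T <= T `^ (e - 1).
Proof.
move=> q1 /andP[e0 e1] /andP[lT uT].
have q0 : 0 < q by lra.
have P0 : 0 < q `^ e^-1 by apply: powR_gt0.
have T0 : 0 < T by lra.
have qE : q = (q `^ e^-1) `^ e by rewrite -powRrM mulVf ?lt0r_neq0// powRr1// ltW.
rewrite powRB ?(lt0r_neq0 T0) ?implybT// powRr1 ?(ltW T0)// mulrA.
rewrite !ler_pM2r ?invr_gt0//; apply/andP; split.
  have T4 : T / 4 <= q `^ e^-1 by lra.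
  have : (T / 4) `^ e <= q.
    by rewrite [leRHS]qE; apply: (ge0_ler_powR (ltW e0)); rewrite ?nnegrE; lra.
  apply: le_trans; rewrite powRM ?(ltW T0) ?invr_ge0// mulrC ler_pM2l ?powR_gt0//.
  by apply: ger1_powR => //; apply/andP; split; lra.
by rewrite [leLHS]qE; apply: (ge0_ler_powR (ltW e0)); rewrite ?nnegrE; lra.
Qed.

Lemma exponent_attained (x : R) : 0 <= x <= 1 / 2 ->
  exists theta, [/\ 1 < theta, irrational theta &
    weak_uniform_exponent (theta_lattice theta) = x%:E].
Proof.
move=> /andP[x0 x12].
(* Stays below 1/2 even for [x = 1 / 2], so that [1 - 2 * xi n] is positive and can be inverted in
   [b n]. *)
pose xi n : R := x - x / n.+1%:R.
have frac n : 0 < (n.+1%:R^-1 : R) <= 1.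
  by rewrite invr_gt0 ltr0n/= invf_le1 ?ltr0n// ler1n.
have xi_le n : xi n <= x.
  by rewrite gerBl divr_ge0.
have e_itv n : 0 < 1 - 2 * xi n <= 1.
  have /andP[] := frac n; rewrite /xi; move: n.+1%:R^-1 => f f0 f1.
  have : 0 <= (1 - 2 * x) * (1 - f) by apply: mulr_ge0; lra.
  have : 0 <= x * (1 - f) by apply: mulr_ge0; lra.
  by move=> ? ?; apply/andP; split; lra.
pose b n : R := (1 - 2 * xi n)^-1.
have b1 n : 1 <= b n.
  by have /andP[? ?] := e_itv n; rewrite /b invf_ge1.
(* With [y = q]^ (b n - 1) >= 1[, adding 3 gives]a - 1 >= y[and]a <= 4 * y[, so]q
   n.+1[lies between]q n [^ b n] and four times it. *)
pose a (n : nat) (z : int) : int :=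
  (Num.truncn ((z%:~R : R) `^ (b n - 1)))%:Z + 3.
have [n z|theta [p [q [th1 pq q_rec]]]] := exists_convergents a.
  by rewrite /a; lia.
have q1 n : 1 <= (q n)%:~R :> R by exact: convergents_q_ge1 pq n.
have rate n := powR_quotient_bounds (q n)%:~R (q n.+1)%:~R
  (1 - 2 * xi n) (q1 n) (e_itv n).
have eE n : 1 - 2 * xi n - 1 = - (2 * xi n) by ring.
have {}rate n : 4^-1 * (q n.+1)%:~R `^ (- (2 * xi n)) <=
    (q n)%:~R / (q n.+1)%:~R <= ((q n.+1)%:~R : R) `^ (- (2 * xi n)).
  rewrite -eE; apply: rate; rewrite -/(b n).
  rewrite -mulr_powRB1; [|by have := q1 n; lra|by have := b1 n; lra].
  have y1 : 1 <= (q n)%:~R `^ (b n - 1) :> R.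
    by rewrite -[leLHS](powRr0 (q n)%:~R) ler_powR//; have := b1 n; lra.
  have := q_rec n; rewrite -2!(ler_int R) !rmorphM rmorphB /= /a rmorphD /=.
  have /andP[] := truncn_itv (le_trans ler01 y1).
  rewrite -[_.+1%:R]natr1 -[(Num.truncn _)%:~R]/((Num.truncn _)%:R).
  move: (q1 n) y1; move: (_ `^ _) => y qn1 y1 lo hi /andP[lq uq].
  by apply/andP; split; nra.
exists theta; split=> //; first exact: convergents_irrational pq.
apply/eqP; rewrite eq_le; apply/andP; split.
  apply: exponent_le => // gamma xg.
  apply: (not_approximable _ _ xi _ _ th1 pq) => //; first by rewrite x0.
  by move=> n; case/andP: (rate n).
apply: exponent_ge => // gamma gx.
have [g0|g0] := ltP gamma 0; first exact: approximable_near_neg.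
pose gamma' := (gamma + x) / 2.
(* From this index on, [x / n.+1] is at most [x - gamma'], that is, [gamma' <= xi n]. *)
pose N := Num.truncn (x / (x - gamma')).
apply: (near_approximable _ xi _ _ th1 pq gamma gamma' N).
- by rewrite g0 /gamma' /=; lra.
- move=> n Nn; rewrite /xi.
  have d0 : 0 < x - gamma' by rewrite /gamma'; lra.
  rewrite lerBrDr addrC -lerBrDr.
  rewrite ler_pdivrMr ?ltr0n// mulrC -ler_pdivrMr//.
  by apply/ltW/(lt_le_trans (truncnS_gt _)); rewrite ler_nat.
- by move=> n; case/andP: (rate n).
Qed.

End Exponent.

Theorem theorem2 (R : realType) :
  (forall theta : R, 1 < theta -> rational theta ->
     weak_uniform_exponent (theta_lattice theta) = +oo%E) /\
  [set weak_uniform_exponent (theta_lattice theta)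
     | theta in [set theta : R | 1 < theta /\ irrational theta]]
  = [set x%:E | x in `[0 : R, 1 / 2]].
Proof.
split; first exact: exponent_rational.
apply/seteqP; split=> [_ [theta /= [th1 irr] <-]|_ [x /= x_itv <-]].
  have ge0 := exponent_ge0 _ th1; have le12 := exponent_le_half _ th1 irr.
  have fin : weak_uniform_exponent (theta_lattice theta) \is a fin_num.
    by rewrite ge0_fin_numE// (le_lt_trans le12)// ltry.
  exists (fine (weak_uniform_exponent (theta_lattice theta))).
    by rewrite /= in_itv/= -!lee_fin fineK// ge0.
  by rewrite fineK.
have [|theta [th1 irr E]] := exponent_attained x.
  by move: x_itv; rewrite in_itv.
by exists theta.
Qed.
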